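(* For every integer $k\ge 1$ there exists $n_0(k)$ such that for every integer $n>n_0(k)$, \[ \alpha[J_{\pm}(n,k,even)] = 2^k\,\alpha[J(n,k,even)] \qquad\text{and}\qquad \alpha[J_{\pm}(n,k,odd)] = 2^k\,\alpha[J(n,k,odd)]. \]
   Context: For integers $n\ge k\ge 1$: $J(n,k,even)$ (respectively $J(n,k,odd)$) is the graph, possibly with loops, whose vertex set consists of all vectors in $\{0,1\}^n$ with exactly $k$ nonzero coordinates, where two (not necessarily distinct) vertices are joined by an edge if and only if their scalar product is even (respectively odd). Likewise, $J_{\pm}(n,k,even)$ (respectively $J_{\pm}(n,k,odd)$) is the graph, possibly with loops, whose vertex set consists of all vectors in $\{-1,0,1\}^n$ with exactly $k$ nonzero coordinates, where two (not necessarily distinct) vertices are joined by an edge if and only if their scalar product is even (respectively odd). Thus every vertex has a loop in the ''even'' graphs when $k$ is even, and in the ''odd'' graphs when $k$ is odd. An independent set is a set of vertices $I$ such that no edge (including a loop) connects vertices of $I$; the independence number $\alpha[G]$ is the maximum size of an independent set in $G$ (it is $0$ if every vertex has a loop). *)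

(* Defs.v *)
From HB Require Import structures.
From mathcomp Require Import all_boot all_order all_algebra.

Set Implicit Arguments.
Unset Strict Implicit.
Unset Printing Implicit Defensive.

Import GRing.Theory.
Local Open Scope ring_scope.

(* An edge relation that is not required to be irreflexive: a loop at x is
   [edge x x]. *)
Record loop_graph := LoopGraph {
  vertex :> finType;
  edge : rel vertex;
  edge_sym : symmetric edge
}.

(* x and y may coincide, so an independent set contains no vertex with a loop. *)
Definition independent (G : loop_graph) (I : {set G}) : bool :=
  [forall x in I, forall y in I, ~~ edge x y].

Definition alpha (G : loop_graph) : nat :=
  (\max_(I : {set G} | independent I) #|I|)%N.

(* Vectors in S^n for a finite set S of integers given by enumeration;
   the coordinates of x are the integers [val (x i)]. *)
Definition vec (S : seq int) (n : nat) := {ffun 'I_n -> seq_sub S}.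

Definition weight (S : seq int) (n : nat) (x : vec S n) : nat :=
  #|[set i | val (x i) != 0]|.

Definition scalar_product (S : seq int) (n : nat) (x y : vec S n) : int :=
  \sum_(i < n) val (x i) * val (y i).

Definition kvec (S : seq int) (n k : nat) := {x : vec S n | weight x == k}.

Lemma scalar_productC (S : seq int) (n : nat) (x y : vec S n) :
  scalar_product x y = scalar_product y x.
Proof. by apply: eq_bigr => i _; rewrite mulrC. Qed.

Definition even_edge (S : seq int) (n k : nat) : rel (kvec S n k) :=
  fun x y => (2 %| scalar_product (val x) (val y))%Z.

Definition odd_edge (S : seq int) (n k : nat) : rel (kvec S n k) :=
  fun x y => ~~ (2 %| scalar_product (val x) (val y))%Z.

Lemma even_edge_sym (S : seq int) (n k : nat) : symmetric (@even_edge S n k).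
Proof. by move=> x y; rewrite /even_edge scalar_productC. Qed.

Lemma odd_edge_sym (S : seq int) (n k : nat) : symmetric (@odd_edge S n k).
Proof. by move=> x y; rewrite /odd_edge scalar_productC. Qed.

Definition J_even (n k : nat) : loop_graph :=
  LoopGraph (@even_edge_sym [:: 0; 1] n k).

Definition J_odd (n k : nat) : loop_graph :=
  LoopGraph (@odd_edge_sym [:: 0; 1] n k).

Definition Jpm_even (n k : nat) : loop_graph :=
  LoopGraph (@even_edge_sym [:: -1; 0; 1] n k).

Definition Jpm_odd (n k : nat) : loop_graph :=
  LoopGraph (@odd_edge_sym [:: -1; 0; 1] n k).

(* Main.v *)
Require Import Defs.
From mathcomp Require Import all_boot all_order all_algebra.

(** Modulo 2 a sign change is invisible, so the parity of a scalar product
depends only on the supports.  Hence the signed graph is the blow-up of the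
unsigned one in which every vertex is replaced by the [2 ^ k] signed vectors
with the same support; a loop at a vertex becomes a complete graph with loops
on its fibre, and a loopless vertex an independent fibre.  A maximum
independent set of a blow-up is a union of fibres. *)

Set Implicit Arguments.
Unset Strict Implicit.
Unset Printing Implicit Defensive.

Import GRing.Theory.
Local Open Scope ring_scope.

Lemma independentP (G : loop_graph) (I : {set G}) :
  reflect {in I &, forall x y, ~~ edge x y} (independent I).
Proof.
apply: (iffP forall_inP) => [indI x y /indI/forall_inP indx /indx //|indI x Ix].
by apply/forall_inP => y; apply: indI.
Qed.

Lemma alpha_attained (G : loop_graph) :
  exists2 I : {set G}, independent I & alpha G = #|I|.
Proof.
have ind0 : independent (set0 : {set G}).
  by apply/independentP => x y; rewrite inE.
rewrite /alpha (bigmax_eq_arg set0) //.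
by case: arg_maxnP => // I indI _; exists I.
Qed.

(** Since [f] preserves and reflects edges, images and preimages of independent sets are
    independent, and a preimage is exactly [m] times as large as the set. *)
Lemma alpha_blowup (G H : loop_graph) (f : G -> H) (m : nat) :
    (forall x y, edge x y = edge (f x) (f y)) ->
    (forall y, #|[set x | f x == y]| = m) ->
  alpha G = (m * alpha H)%N.
Proof.
move=> f_edge f_fiber.
have card_preim (S : {set H}) : #|f @^-1: S| = (m * #|S|)%N.
  rewrite -sum1_card (partition_big f (mem S)) => [|x]; last by rewrite inE.
  rewrite (eq_bigr (fun=> m)) => [|y Sy]; first by rewrite sum_nat_const mulnC.
  rewrite -(f_fiber y) -sum1_card; apply: eq_bigl => x.
  by rewrite !inE; apply: andb_idl => /eqP ->.
apply: anti_leq; apply/andP; split.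
  apply/bigmax_leqP => I /independentP indI.
  (* Saturate [I] to the union of all fibres that it meets. *)
  apply: (@leq_trans #|f @^-1: (f @: I)|).
    by apply/subset_leq_card/subsetP => x Ix; rewrite inE imset_f.
  rewrite card_preim leq_mul2l; apply/orP; right.
  apply: (@leq_bigmax_cond _ _ (fun A : {set H} => #|A|)).
  apply/independentP => _ _ /imsetP[x Ix ->] /imsetP[y Iy ->].
  by rewrite -f_edge indI.
have [S /independentP indS ->] := alpha_attained H.
rewrite -card_preim; apply: (@leq_bigmax_cond _ _ (fun A : {set G} => #|A|)).
by apply/independentP => x y; rewrite !inE f_edge; apply: indS.
Qed.

Notation sign := (seq_sub [:: -1; 0; 1 : int]).
Notation bit := (seq_sub [:: 0; 1 : int]).

Definition bit0 : bit := @SeqSub int [:: 0; 1] 0 isT.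
Definition bit1 : bit := @SeqSub int [:: 0; 1] 1 isT.

Definition abs_sign (a : sign) : bit := if val a == 0 then bit0 else bit1.

Lemma abs_sign_eq0 (a : sign) : (val (abs_sign a) == 0) = (val a == 0).
Proof. by rewrite /abs_sign; case: ifP. Qed.

(** The difference is [ab - |ab|], which is 0 or -2; all nine cases are checked. *)
Lemma abs_sign_mul_parity (a b : sign) :
  (2 %| val a * val b - val (abs_sign a) * val (abs_sign b))%Z.
Proof.
rewrite /abs_sign; case: a b => [a a_in] [b b_in] /=; move: a_in b_in.
by rewrite !inE => /or3P[] /eqP-> /or3P[] /eqP->.
Qed.

(** The fibre over 1 is [{-1, 1}] and the fibre over 0 is [{0}]. *)
Lemma card_abs_sign_fiber (b : bit) :
  #|[pred a | abs_sign a == b]| = (if val b != 0 then 2 else 1)%N.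
Proof.
pose sN : sign := @SeqSub int [:: -1; 0; 1] (-1) isT.
pose s0 : sign := @SeqSub int [:: -1; 0; 1] 0 isT.
pose s1 : sign := @SeqSub int [:: -1; 0; 1] 1 isT.
case: b => b b_in /=; case: ifP => b0.
  have -> : 2%N = #|pred2 sN s1| by rewrite card2.
  apply: eq_card => -[a a_in]; rewrite !inE /abs_sign -!val_eqE /=.
  move: a_in b_in b0.
  by rewrite !inE => /or3P[] /eqP-> /orP[] /eqP->.
rewrite -(card1 s0); apply: eq_card => -[a a_in].
rewrite !inE /abs_sign -!val_eqE /=; move: a_in b_in b0.
by rewrite !inE => /or3P[] /eqP-> /orP[] /eqP->.
Qed.

Section AbsVec.
Variables n k : nat.

Definition abs_vec (x : vec [:: -1; 0; 1] n) : vec [:: 0; 1] n :=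
  [ffun i => abs_sign (x i)].

Lemma weight_abs_vec (x : vec [:: -1; 0; 1] n) : weight (abs_vec x) = weight x.
Proof. by apply: eq_card => i; rewrite !inE ffunE abs_sign_eq0. Qed.

Lemma scalar_product_abs_vec (x y : vec [:: -1; 0; 1] n) :
  (2 %| scalar_product (abs_vec x) (abs_vec y))%Z
    = (2 %| scalar_product x y)%Z.
Proof.
have d2 : (2 %| scalar_product x y
                - scalar_product (abs_vec x) (abs_vec y))%Z.
  rewrite /scalar_product -sumrB; apply: rpred_sum => i _.
  by rewrite !ffunE; apply: abs_sign_mul_parity.
(* Adding the even difference [d2] does not affect membership in the subgroup of even integers. *)
by rewrite -[scalar_product x y](subrK (scalar_product (abs_vec x) (abs_vec y)))
  [RHS](rpredDl _ d2).
Qed.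

(** The fibre is a product of coordinate fibres: a free choice of sign at each support coordinate of
    [y], and a forced 0 elsewhere. *)
Lemma card_abs_vec_fiber (y : vec [:: 0; 1] n) :
  #|[pred x | abs_vec x == y]| = (2 ^ weight y)%N.
Proof.
rewrite (@eq_card _ _ (family (fun i => [pred a | abs_sign a == y i]))).
  rewrite card_family foldrE big_map big_enum /=.
  under eq_bigr do rewrite card_abs_sign_fiber.
  (* The factors 1 drop out, leaving a product of 2 over the support. *)
  rewrite -big_mkcond prod_nat_const; congr (2 ^ _)%N.
  by apply: eq_card => i; rewrite !inE.
move=> x; rewrite !inE; apply/eqP/familyP => [<- i | fam].
  by rewrite inE ffunE.
by apply/ffunP => i; rewrite ffunE; apply/eqP/fam.
Qed.

Lemma abs_kvec_subproof (x : kvec [:: -1; 0; 1] n k) :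
  weight (abs_vec (val x)) == k.
Proof. by rewrite weight_abs_vec (valP x). Qed.

Definition abs_kvec (x : kvec [:: -1; 0; 1] n k) : kvec [:: 0; 1] n k :=
  Sub (abs_vec (val x)) (abs_kvec_subproof x).

(** Since [abs_vec] preserves weight, every signed vector above [y] has weight [k], so restricting
    to [kvec] keeps the whole fibre. *)
Lemma card_abs_kvec_fiber (y : kvec [:: 0; 1] n k) :
  #|[set x | abs_kvec x == y]| = (2 ^ k)%N.
Proof.
have <- : #|[pred x | abs_vec x == val y]| = (2 ^ k)%N.
  by rewrite card_abs_vec_fiber (eqP (valP y)).
rewrite -(card_imset _ val_inj).
apply: eq_card => x; rewrite inE; apply/imsetP/eqP => [[z + ->] | xy].
  by rewrite inE => /eqP <-.
have wx : weight x == k by rewrite -weight_abs_vec xy (valP y).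
by exists (Sub x wx); rewrite ?inE -?val_eqE /= ?xy.
Qed.

End AbsVec.

Theorem proposition2 (k : nat) (hk : (1 <= k)%N) :
  exists n0 : nat, forall n : nat, (n0 < n)%N ->
    alpha (Jpm_even n k) = (2 ^ k * alpha (J_even n k))%N /\
    alpha (Jpm_odd n k) = (2 ^ k * alpha (J_odd n k))%N.
Proof.
(* The fibre size [2 ^ k] does not depend on [n], which allows the threshold 0. *)
exists 0%N => n _; split.
  apply: (@alpha_blowup (Jpm_even n k) (J_even n k) (@abs_kvec n k)).
    by move=> x y; rewrite /= /even_edge scalar_product_abs_vec.
  exact: card_abs_kvec_fiber.
apply: (@alpha_blowup (Jpm_odd n k) (J_odd n k) (@abs_kvec n k)).
  by move=> x y; rewrite /= /odd_edge scalar_product_abs_vec.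
exact: card_abs_kvec_fiber.
Qed.
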